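(* Let $d\ge1$, $n=d+1$, $s\ge2$, let $\Phi$ be a non-increasing function tending to zero at infinity, and let $\bm{\Theta}=(\bm{\theta}_1,\dots,\bm{\theta}_s)\in UDT_s^d(\Phi)$. Then the set $\mathfrak{F}(\bm{\Theta})$ is a dense forest in $\mathbb{R}^n$ with visibility function satisfying $$v(\varepsilon)=O\left(\left(\varepsilon^{d-1}\,\Phi(d\varepsilon^{-1})^{-1}\right)^d\right)\quad(\varepsilon\to0).$$
   Context: Let $\langle x\rangle$ denote the distance from $x\in\mathbb{R}$ to $\mathbb{Z}$. An $s$-tuple $\bm{\Theta}=(\bm{\theta}_1,\dots,\bm{\theta}_s)$ of vectors in $\mathbb{R}^d$ is uniformly Diophantine of type $\Phi$, written $\bm{\Theta}\in UDT_s^d(\Phi)$, if for every real $T\ge1$ and every $\bm{\xi}\in\mathbb{R}^d$ there is $i\in\{1,\dots,s\}$ such that for all $\bm{u}\in\mathbb{Z}^d\setminus\{\bm{0}\}$ with $\|\bm{u}\|_\infty\le T$, $\langle\bm{u}\cdot(\bm{\xi}-\bm{\theta}_i)\rangle\ge\Phi(T)$. Define $\mathfrak{F}_1(\bm{\Theta})=\bigcup_{i=1}^s\begin{pmatrix}1&\bm{0}^T\\ \bm{\theta}_i&I_d\end{pmatrix}\mathbb{Z}^n$, let $J(x_1,\dots,x_n)^T=(x_2,\dots,x_n,x_1)^T$, and $\mathfrak{F}(\bm{\Theta})=\bigcup_{\ell=1}^nJ^{\ell-1}(\mathfrak{F}_1(\bm{\Theta}))$. A set $Y$ is a dense forest with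 visibility function $v$ if for every $\varepsilon>0$ every line segment of length $v(\varepsilon)$ comes within distance $\varepsilon$ of $Y$ (any fixed norm on $\mathbb{R}^n$; the implied constant may depend on the norm, $d$, $s$, $\Phi$).
   Formalization: The norm on R^n is assumed to give each standard basis vector norm at most 1 (all l^p norms qualify), since for an arbitrary norm such as 5 times the sup norm the bound fails for some non-doubling Φ; Φ is assumed positive on [1,∞) so that Φ(d/ε)^{-1} is defined. *)

(* Defs.v *)
From HB Require Import structures.
From mathcomp Require Import all_boot all_order all_algebra.
From mathcomp Require Import all_classical all_reals all_analysis.

Set Implicit Arguments.
Unset Strict Implicit.
Unset Printing Implicit Defensive.

Import Order.TTheory GRing.Theory Num.Theory.
Import numFieldNormedType.Exports.

Local Open Scope classical_set_scope.
Local Open Scope ring_scope.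

Section Diophantine.
Variable R : realType.

Definition distZ (x : R) : R := inf [set `|x - k%:~R| | k in [set: int]].

Definition intvec (m : nat) (u : 'cV[int]_m) : 'cV[R]_m := map_mx intr u.

Definition dotv (m : nat) (x y : 'cV[R]_m) : R := \sum_(j < m) x j 0 * y j 0.

(* The norm of [intvec u] is the library norm on matrices, i.e. the sup norm. *)
Definition UDT (d s : nat) (Phi : R -> R) (Theta : 'I_s -> 'cV[R]_d) : Prop :=
  forall T : R, 1 <= T -> forall xi : 'cV[R]_d,
  exists i : 'I_s, forall u : 'cV[int]_d,
    u != 0 -> `|intvec u| <= T ->
    Phi T <= distZ (dotv (intvec u) (xi - Theta i)).

Definition shear (d : nat) (theta : 'cV[R]_d) : 'M[R]_(1 + d) :=
  block_mx 1%:M 0 theta 1%:M.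

Definition forest1 (d s : nat) (Theta : 'I_s -> 'cV[R]_d) : set 'cV[R]_(1 + d) :=
  \bigcup_(i in [set: 'I_s])
    [set shear (Theta i) *m intvec z | z in [set: 'cV[int]_(1 + d)]].

Definition rotv (n : nat) (x : 'cV[R]_n) : 'cV[R]_n := \col_j x (ordS j) 0.

(* The index l runs over 0, ..., d, so it stands for the exponent of J. *)
Definition forest (d s : nat) (Theta : 'I_s -> 'cV[R]_d) : set 'cV[R]_(1 + d) :=
  \bigcup_(l in [set: 'I_(1 + d)]) (iter l (@rotv (1 + d)) @` forest1 Theta).

Definition is_norm (n : nat) (N : 'cV[R]_n -> R) : Prop :=
  [/\ forall x, N x = 0 -> x = 0,
      forall (a : R) x, N (a *: x) = `|a| * N x
    & forall x y, N (x + y) <= N x + N y].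

Definition segment (n : nat) (x y : 'cV[R]_n) : set 'cV[R]_n :=
  [set x + t *: (y - x) | t in `[0, 1]].

(* Positivity of [v] is part of the definition: no segment has negative length,
   so a negative [v] would be a visibility function for every set. *)
Definition dense_forest (n : nat) (N : 'cV[R]_n -> R) (Y : set 'cV[R]_n)
    (v : R -> R) : Prop :=
  forall eps : R, 0 < eps ->
    0 < v eps /\
    forall x y : 'cV[R]_n, N (y - x) = v eps ->
      exists p q, [/\ segment x y p, Y q & N (p - q) <= eps].

End Diophantine.

(* Main.v *)
Require Import Defs.
From HB Require Import structures.
From mathcomp Require Import all_boot all_order all_algebra.
From mathcomp Require Import all_classical all_reals all_analysis.
From mathcomp Require Import complex ring lra zify.

(** A segment whose [l]-th coordinate varies most meets many hyperplanes
    [x_l = k], [k] an integer; there its position relative to the points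
    [(k, k theta_i + m)] is an orbit of the translation by [alpha - theta_i] of
    the torus, [alpha] being the slope vector.  The hypothesis provides [i] such
    that this translation has no resonance [u] with [|u| <= T = d / eps] up to
    [Phi T].  A duality argument then shows that an orbit of length [O(1 / Phi T)]
    meets every [l^1]-ball of radius [eps]: test against a product of squared
    trigonometric polynomials of degree less than [T] in space and of frequency
    less than [Phi T] in time, which the orbit cannot distinguish from the torus;
    the mean of the squared distance to the centre for such a weight is smaller
    than [eps ^ 2 / d].  Finally, Dirichlet's theorem forces
    [Phi T = O(eps ^ d)], hence [1 / Phi T = O((eps ^ (d - 1) / Phi T) ^ d)]. *)

Set Implicit Arguments.
Unset Strict Implicit.
Unset Printing Implicit Defensive.

Import Order.TTheory GRing.Theory Num.Theory.
Import numFieldNormedType.Exports.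

Local Open Scope classical_set_scope.
Local Open Scope ring_scope.

(** * Exponentials on the circle, and Parseval's identity on a finite cyclic group *)

Section Exponentials.
Variable R : realType.
Implicit Types (x y : R) (z : R[i]).

(** Concavity of the sine: the mean slope [cos a] on [[0, x]] is at least the mean slope [cos b] on
    [[x, pi / 2]]. *)
Lemma jordan_sin x : 0 <= x <= pi / 2 -> x <= pi / 2 * sin x.
Proof.
case/andP; rewrite le_eqVlt => /predU1P[<-|x0]; first by rewrite sin0 mulr0.
rewrite le_eqVlt => /predU1P[->|xp]; first by rewrite sin_pihalf mulr1.
have sinC (A : set R) : {within A, continuous (@sin R)}.
  exact/continuous_subspaceT/continuous_sin.
have [a] := MVT x0 (fun y _ => is_derive_sin y) (sinC _).
rewrite in_itv/= sin0 !subr0 => /andP[a0 ax] Ea.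
have [b] := MVT xp (fun y _ => is_derive_sin y) (sinC _).
rewrite in_itv/= sin_pihalf => /andP[xb bp] Eb.
have p0 : 0 < pi :> R by exact: pi_gt0.
have ba : cos b <= cos a.
  by apply/ltW; rewrite ltr_cos ?in_itv/=; lra.
have : sin x * (pi / 2 - x) >= x * (1 - sin x).
  rewrite Eb Ea mulrCA -mulrA ler_wpM2r// mulr_ge0 ?subr_ge0 ?ltW//.
lra.
Qed.

(** The squared length of the chord from 1 to exp(2 pi i x): a smooth substitute for the squared
    distance to the integers. *)
Definition chord x : R := 2 - 2 * cos (2 * pi * x).

Lemma chordDz x (m : int) : chord (x + m%:~R) = chord x.
Proof.
suff cosn y (n : nat) : cos (2 * pi * (y + n%:R)) = cos (2 * pi * y).
  rewrite /chord; case: (intP m) => [|n|n]; first by rewrite addr0.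
  - by rewrite cosn.
  - by rewrite -(cosn _ n.+1) mulrNz subrK.
elim: n => [|n IHn]; first by rewrite addr0.
rewrite -[RHS]IHn -[RHS]cosD2pi; congr cos.
by rewrite -natr1; ring.
Qed.

(** Since [chord x] is 4 sin^2(pi x), this is Jordan's inequality squared. *)
Lemma chord_ge x : `|x| <= 1 / 2 -> 16 * x ^+ 2 <= chord x.
Proof.
move=> xh; have p0 : 0 < pi :> R by exact: pi_gt0.
have -> : chord x = chord `|x|.
  rewrite /chord; case: (lerP 0 x) => x0; first by rewrite ger0_norm.
  by rewrite ltr0_norm// mulrN cosN.
rewrite -(real_normK (num_real x)); move: `|x| (normr_ge0 x) xh => {}x x0 xh.
have /jordan_sin : 0 <= pi * x <= pi / 2 by apply/andP; split; nra.
have -> : chord x = 4 * sin (pi * x) ^+ 2.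
  rewrite sin2cos2 /chord (_ : 2 * pi * x = (pi * x) *+ 2); last by ring.
  by rewrite cos_mulr2n; ring.
have -> : pi / 2 * sin (pi * x) = pi * (sin (pi * x) / 2) by ring.
rewrite ler_pM2l// => sx.
have : 4 * x ^+ 2 <= sin (pi * x) ^+ 2 by nra.
lra.
Qed.

Lemma exists_int_chord x : exists m : int, 16 * (x - m%:~R) ^+ 2 <= chord x.
Proof.
exists (Num.floor (x + 1 / 2)); rewrite -(chordDz x (- Num.floor (x + 1 / 2))).
rewrite mulrNz; apply: chord_ge.
have /andP[] := floor_itv (x + 1 / 2); rewrite intrD => f1 f2.
by rewrite ler_norml; lra.
Qed.

Definition expi x : R[i] := (cos (2 * pi * x) +i* sin (2 * pi * x))%C.

Lemma expiD x y : expi (x + y) = expi x * expi y.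
Proof.
rewrite /expi mulrDr cosD sinD; apply/eqP; rewrite eq_complex/= eqxx/=.
by apply/eqP; ring.
Qed.

Lemma expi0 : expi 0 = 1.
Proof. by rewrite /expi mulr0 cos0 sin0. Qed.

Lemma expi_natl (n : nat) x : expi (n%:R * x) = expi x ^+ n.
Proof.
elim: n => [|n IHn]; first by rewrite mul0r expi0 expr0.
by rewrite exprS -IHn -expiD -natr1 mulrDl mul1r addrC.
Qed.

Lemma expi_conj x : conjc (expi x) = expi (- x).
Proof. by rewrite /expi/= mulrN cosN sinN. Qed.

Lemma expi_sum (I : finType) (F : I -> R) :
  expi (\sum_i F i) = \prod_i expi (F i).
Proof. by apply: (big_morph expi expiD expi0). Qed.

Lemma expi_chord x : complex.Re (expi x) = 1 - chord x / 2.
Proof. by rewrite /= /chord; lra. Qed.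

Lemma expi_int (m : int) : expi m%:~R = 1.
Proof.
have c1 : cos (2 * pi * m%:~R) = 1 :> R.
  have := chordDz 0 m; rewrite /chord add0r mulr0 cos0; lra.
rewrite /expi c1 cos1sin0 ?c1 ?normr1//.
Qed.

Lemma expi_eq1 x : expi x = 1 -> exists m : int, x = m%:~R.
Proof.
move=> ex1; have [m] := exists_int_chord x; exists m.
have := expi_chord x; rewrite ex1/= => cx.
have : (x - m%:~R) ^+ 2 <= 0 by lra.
by rewrite le_eqVlt ltNge sqr_ge0 orbF sqrf_eq0 subr_eq0 => /eqP.
Qed.

Definition normsq z : R := complex.Re z ^+ 2 + complex.Im z ^+ 2.

Lemma normsqE z : ((normsq z)%:C)%C = z * conjc z.
Proof.
case: z => a b; apply/eqP; rewrite /normsq eq_complex/=.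
by apply/andP; split; apply/eqP; ring.
Qed.

Lemma normsqM z1 z2 : normsq (z1 * z2) = normsq z1 * normsq z2.
Proof. by case: z1 z2 => [a b] [a' b']; rewrite /normsq/=; ring. Qed.

Lemma normsq_ge0 z : 0 <= normsq z.
Proof. by rewrite addr_ge0 ?sqr_ge0. Qed.

Lemma normsq_expi x : normsq (expi x) = 1.
Proof. by rewrite /normsq/= cos2Dsin2. Qed.

Lemma normsq_real x : normsq (x%:C)%C = x ^+ 2.
Proof. by rewrite /normsq/= expr0n addr0. Qed.

Lemma normsq_prod (I : finType) (F : I -> R[i]) :
  normsq (\prod_i F i) = \prod_i normsq (F i).
Proof.
by apply: (big_morph normsq normsqM); rewrite /normsq/= expr1n expr0n addr0.
Qed.

Lemma normsq_chord x : normsq (expi (- x) - 1) = chord x.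
Proof.
rewrite /normsq /chord /= mulrN cosN sinN subr0 sqrrN sin2cos2; ring.
Qed.

(** Orthogonality of the characters of Z/Q: a geometric sum whose ratio is a [Q]-th root of unity,
    equal to 1 only if [Q] divides [m]. *)
Lemma sum_expi (Q : nat) (m : int) : (0 < Q)%N ->
  \sum_(k < Q) expi (k%:R * (m%:~R / Q%:R)) =
    (if (Q%:Z %| m)%Z then Q%:R else 0).
Proof.
move=> Q0; have Qn0 : Q%:R != 0 :> R by rewrite pnatr_eq0 -lt0n.
under eq_bigr do rewrite expi_natl.
case: ifPn => [/dvdzP[q ->]|ndv].
  rewrite intrM mulfK// expi_int.
  by under eq_bigr do rewrite expr1n; rewrite sumr_const card_ord.
have /eqP := subrX1 (expi (m%:~R / Q%:R)) Q.
rewrite -expi_natl [_%:R * _]mulrC divfK// expi_int subrr eq_sym mulf_eq0.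
case/predU1P => [/eqP|/eqP//]; rewrite subr_eq0 => /eqP/expi_eq1[q Eq].
case/negP: ndv; apply/dvdzP; exists q; apply/(@intr_inj R).
by rewrite intrM -Eq divfK.
Qed.

(** Expand the square and sum over [k] first: the frequencies are distinct modulo [Q], so only the
    diagonal terms survive. *)
Lemma parseval (A : finType) (P : pred A) (g : A -> R[i]) (th : A -> int)
    (Q : nat) : (0 < Q)%N ->
  (forall a b, P a -> P b -> (Q%:Z %| th a - th b)%Z -> a = b) ->
  \sum_(k < Q) normsq (\sum_(a | P a)
      g a * expi (k%:R * ((th a)%:~R / Q%:R))) =
  Q%:R * \sum_(a | P a) normsq (g a).
Proof.
move=> Q0 inj; apply: (@complexI R).
have conjM z1 z2 : conjc (z1 * z2) = conjc z1 * conjc z2 :> R[i].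
  exact: rmorphM.
rewrite rmorphM !rmorph_sum/= rmorph_nat.
under eq_bigr => k _.
  rewrite normsqE (rmorph_sum conjc) big_distrlr/=.
  under eq_bigr => a _ do under eq_bigr => b _ do
    rewrite conjM expi_conj mulrACA -expiD -mulrN -mulrDr -mulNr -mulrDl
      -intrB.
  over.
rewrite exchange_big/= big_distrr/=; apply: eq_bigr => a Pa.
rewrite exchange_big/= (bigD1 a)//= -big_distrr/= sum_expi// subrr dvdz0.
rewrite big1 ?addr0 ?normsqE 1?mulrC// => b /andP[Pb ba].
rewrite -big_distrr/= sum_expi//; case: ifPn => [|_]; last by rewrite mulr0.
by move/inj => /(_ Pa Pb) E; rewrite E eqxx in ba.
Qed.

(** The expanded product has one term for each choice [f] of exponents, with frequency [th f]. Two
    choices differ by a vector [c] with entries below [L], so the absence of resonances makes the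
    frequencies distinct modulo [Q]. The mean over the orbit is thus the mean over the whole
    torus. *)
Lemma parseval_prod (I : finType) (L : I -> nat) (b : I -> int) (x : I -> R)
    (Q : nat) (w : I -> nat -> R) : (0 < Q)%N ->
  (forall c : I -> int, (forall i, `|c i| < (L i)%:Z) ->
     (Q%:Z %| \sum_i c i * b i)%Z -> forall i, c i = 0) ->
  \sum_(k < Q) normsq (\prod_i \sum_(a < L i) ((w i a)%:C)%C *
      expi (a%:R * (x i + k%:R * ((b i)%:~R / Q%:R)))) =
  Q%:R * \prod_i \sum_(a < L i) w i a ^+ 2.
Proof.
move=> Q0 nores; pose m := \max_i L i.
have Lm i : (L i <= m)%N by exact: leq_bigmax.
pose P (f : {ffun I -> 'I_m}) := f \in family (fun i (a : 'I_m) => (a < L i)%N).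
pose g (f : {ffun I -> 'I_m}) : R[i] :=
  \prod_i (((w i (f i))%:C)%C * expi ((f i)%:R * x i)).
pose th (f : {ffun I -> 'I_m}) : int := \sum_i (f i)%:Z * b i.
rewrite (eq_bigr (fun k : 'I_Q => normsq (\sum_(f | P f)
   g f * expi (k%:R * ((th f)%:~R / Q%:R))))); last first.
  move=> k _; congr normsq.
  under eq_bigr => i _ do rewrite (big_ord_widen _
    (fun a : nat => ((w i a)%:C)%C *
      expi (a%:R * (x i + k%:R * ((b i)%:~R / Q%:R)))) (Lm i)).
  rewrite bigA_distr_big_dep; apply: eq_bigr => f _.
  have -> : k%:R * ((th f)%:~R / Q%:R) =
      \sum_i (f i)%:R * (k%:R * ((b i)%:~R / Q%:R)) :> R.
    rewrite /th rmorph_sum/= mulr_suml mulr_sumr; apply: eq_bigr => i _.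
    by rewrite intrM; ring.
  rewrite expi_sum -big_split/=; apply: eq_bigr => i _.
  by rewrite mulrDr expiD mulrA.
rewrite parseval//; last first.
  move=> f f' /familyP Pf /familyP Pf' dv.
  have E := nores (fun i => (f i)%:Z - (f' i)%:Z).
  apply/ffunP => i; apply/val_inj.
  suff : (f i)%:Z - (f' i)%:Z = 0 by move/eqP; rewrite subr_eq0 => /eqP[].
  apply: E => {i}[i|].
    by have := Pf i; have := Pf' i; rewrite !unfold_in/=; lia.
  move: dv; rewrite /th -sumrB.
  by under eq_bigr do rewrite -mulrBl.
congr (_ * _).
under [in RHS]eq_bigr => i _ do
  rewrite (big_ord_widen _ (fun a : nat => w i a ^+ 2) (Lm i)).
rewrite bigA_distr_big_dep; apply: eq_bigr => f _.
rewrite normsq_prod; apply: eq_bigr => i _.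
by rewrite normsqM normsq_expi mulr1 normsq_real.
Qed.

End Exponentials.

(** * A quantitative Kronecker theorem for finite cyclic orbits *)

Section DiscreteKronecker.
Variable R : realType.

Lemma sum_parabola_sq (L : nat) :
  \sum_(a < L) (a%:R * (L%:R - a%:R)) ^+ 2 =
    L%:R * (L%:R ^+ 4 - 1) / 30 :> R.
Proof.
(* Separating the parameter [x] from the summation bound [n] makes induction on [n] possible. *)
suff E (x : R) n : \sum_(a < n) (a%:R * (x - a%:R)) ^+ 2 =
    x ^+ 2 * (n%:R * (n%:R - 1) * (2 * n%:R - 1)) / 6
    - x * (n%:R * (n%:R - 1)) ^+ 2 / 2
    + n%:R * (n%:R - 1) * (2 * n%:R - 1) * (3 * n%:R ^+ 2 - 3 * n%:R - 1) / 30.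
  by rewrite E; field.
elim: n => [|n IHn]; first by rewrite big_ord0; field.
by rewrite big_ord_recr/= IHn -natr1; field.
Qed.

Lemma sum_parabola_diff_sq (L : nat) :
  \sum_(a < L) (L%:R - 2 * a%:R - 1) ^+ 2 = L%:R * (L%:R ^+ 2 - 1) / 3 :> R.
Proof.
suff E (x : R) n : \sum_(a < n) (x - 2 * a%:R - 1) ^+ 2 =
    (x - 1) ^+ 2 * n%:R - 2 * (x - 1) * (n%:R * (n%:R - 1))
    + 2 * (n%:R * (n%:R - 1) * (2 * n%:R - 1)) / 3.
  by rewrite E; field.
elim: n => [|n IHn]; first by rewrite big_ord0; field.
by rewrite big_ord_recr/= IHn -natr1; field.
Qed.

(** Summation by parts: the factor turns coefficients into forward differences, and the boundary
    terms vanish with [p] at both ends. *)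
Lemma mul_expi_sum (p : nat -> R) (y : R) (n : nat) : p 0%N = 0 -> p n = 0 ->
  (expi (- y) - 1) * (\sum_(a < n) ((p a)%:C)%C * expi (a%:R * y)) =
  \sum_(a < n) ((p a.+1 - p a)%:C)%C * expi (a%:R * y).
Proof.
move=> p0 pn.
suff E m : (expi (- y) - 1) * (\sum_(a < m) ((p a)%:C)%C * expi (a%:R * y)) =
    \sum_(a < m) ((p a.+1 - p a)%:C)%C * expi (a%:R * y)
    - ((p m)%:C)%C * (expi (- y) * expi (m%:R * y)).
  by rewrite E pn mul0r subr0.
elim: m => [|m IHm]; first by rewrite !big_ord0 p0 mul0r mulr0 subr0.
rewrite !big_ord_recr/= mulrDr IHm -!expiD.
have -> : - y + m.+1%:R * y = m%:R * y by rewrite -natr1; ring.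
have -> : ((p m.+1 - p m)%:C)%C = ((p m.+1)%:C)%C - ((p m)%:C)%C :> R[i].
  exact: rmorphB.
by rewrite expiD; ring.
Qed.

Lemma exists_le_weighted_mean (n : nat) (w f : 'I_n -> R) (B : R) :
  (forall k, 0 <= w k) -> 0 < \sum_k w k ->
  \sum_k w k * f k = B * \sum_k w k -> exists k, f k <= B.
Proof.
move=> w0 wpos E; apply: contrapT => /forallNP fB.
have {}fB k : B < f k by rewrite ltNge; exact/negP/fB.
have /eqP : \sum_k w k * (f k - B) = 0.
  rewrite (eq_bigr (fun k => w k * f k - B * w k)); last by move=> k _; ring.
  by rewrite sumrB E mulr_sumr subrr.
rewrite psumr_eq0; last by move=> k _; rewrite mulr_ge0// subr_ge0 ltW.
move=> /allP wf; move: wpos; rewrite big1 ?ltxx// => k _.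
have := wf k (mem_index_enum _); rewrite /= mulf_eq0 subr_eq0.
by rewrite (gt_eqF (fB k)) orbF => /eqP.
Qed.

(* The test function is the product of the polynomials with coefficients
   [a (L - a)], a discrete analogue of the first Dirichlet eigenfunction of an
   interval.  It is concentrated near 0, and its frequencies are too small for
   the subgroup generated by [b / Q] to tell its mean from that over the torus. *)
Lemma discrete_kronecker (I : finType) (L : I -> nat) (b : I -> int)
    (x lam : I -> R) (Q : nat) : (0 < Q)%N -> (forall i, 2 <= L i)%N ->
  (forall c : I -> int, (forall i, `|c i| < (L i)%:Z) ->
     (Q%:Z %| \sum_i c i * b i)%Z -> forall i, c i = 0) ->
  exists k : 'I_Q,
    \sum_i lam i * chord (x i + k%:R * ((b i)%:~R / Q%:R)) <=
    \sum_i lam i * (10 / ((L i)%:R ^+ 2 + 1)).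
Proof.
move=> Q0 L2 nores.
pose y i (k : 'I_Q) := x i + k%:R * ((b i)%:~R / Q%:R).
pose p i (a : nat) : R := a%:R * ((L i)%:R - a%:R).
pose dp i (a : nat) : R := p i a.+1 - p i a.
pose S (w : I -> nat -> R) k : R[i] :=
  \prod_i \sum_(a < L i) ((w i a)%:C)%C * expi (a%:R * y i k).
have parS w : \sum_k normsq (S w k) = Q%:R * \prod_i \sum_(a < L i) w i a ^+ 2.
  exact: parseval_prod.
have p_gt0 i : 0 < \sum_(a < L i) p i a ^+ 2.
  rewrite sum_parabola_sq.
  have L1 : 1 < (L i)%:R :> R by rewrite ltr1n.
  by rewrite divr_gt0// mulr_gt0 ?(lt_trans _ L1)// subr_gt0 exprn_egt1.
(* This quotient of energies is the weighted mean of [chord] in one coordinate. *)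
have dpE i : \sum_(a < L i) dp i a ^+ 2 =
    10 / ((L i)%:R ^+ 2 + 1) * \sum_(a < L i) p i a ^+ 2.
  rewrite sum_parabola_sq.
  rewrite (eq_bigr (fun a : 'I__ => ((L i)%:R - 2 * a%:R - 1) ^+ 2)).
    rewrite sum_parabola_diff_sq; field.
    by rewrite gt_eqF// addr_gt0// exprn_gt0// ltr0n (leq_trans _ (L2 i)).
  by move=> a _; rewrite /dp /p -natr1; congr (_ ^+ 2); ring.
(* Differencing the [i]-th factor absorbs the weight [chord (y i k)] into the squared modulus, so
   that Parseval also evaluates the weighted sum. *)
pose w i j := if j == i then dp j else p j.
have Sw i k : S (w i) k = (expi (- y i k) - 1) * S p k.
  rewrite /S (bigD1 i)//= [in RHS](bigD1 i)//= /w eqxx mulrA; congr (_ * _).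
    by rewrite mul_expi_sum// /p ?mul0r// subrr mulr0.
  by apply: eq_bigr => j /negPf ->.
apply: (@exists_le_weighted_mean _ (fun k => normsq (S p k))).
- by move=> k; exact: normsq_ge0.
- by rewrite parS mulr_gt0 ?ltr0n// prodr_gt0.
under eq_bigr do rewrite mulr_sumr.
rewrite exchange_big/= mulr_suml; apply: eq_bigr => i _.
rewrite (eq_bigr (fun k => lam i * normsq (S (w i) k))); last first.
  by move=> k _; rewrite Sw normsqM normsq_chord; ring.
rewrite -mulr_sumr !parS.
have -> : \prod_j \sum_(a < L j) w i j a ^+ 2 =
    10 / ((L i)%:R ^+ 2 + 1) * \prod_j \sum_(a < L j) p j a ^+ 2.
  rewrite (bigD1 i)//= [in RHS](bigD1 i)//= {1}/w eqxx dpE mulrA.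
  by congr (_ * _); apply: eq_bigr => j /negPf ji; rewrite /w ji.
by rewrite -[RHS]mulrA; congr (_ * _); rewrite mulrCA.
Qed.

End DiscreteKronecker.

(** * From cyclic orbits to translation orbits on the torus *)

Section Kronecker.
Variable R : realType.

Lemma distZ_le (x : R) (k : int) : distZ x <= `|x - k%:~R|.
Proof.
apply: ge_inf; last by exists k.
by exists 0 => _ [m _ <-].
Qed.

Lemma exists_nat_itv (x : R) : 0 <= x -> exists n : nat, n%:R <= x < n.+1%:R.
Proof. by exists (Num.truncn x); exact: truncn_itv. Qed.

Lemma intvec_norm_le (d : nat) (u : 'cV[int]_d) (T : R) : 0 <= T ->
  (forall j, `|(u j 0)%:~R| <= T) -> `|intvec R u| <= T.
Proof.
move=> T0 uT; rewrite [`|_|]mx_normrE; apply: bigmax_le => // -[i j] _ /=.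
by rewrite mxE (ord1 j).
Qed.

(** Adjoins the time coordinate, at index 0, to the [d] space coordinates. *)
Definition consf (A : Type) (d : nat) (a : A) (f : 'I_d -> A) (i : 'I_d.+1) : A :=
  if unlift ord0 i is Some j then f j else a.

Lemma consf0 A d (a : A) (f : 'I_d -> A) : consf a f ord0 = a.
Proof. by rewrite /consf unlift_none. Qed.

Lemma consfS A d (a : A) (f : 'I_d -> A) j : consf a f (lift ord0 j) = f j.
Proof. by rewrite /consf liftK. Qed.

(** Test the hypothesis on the all-ones vector: every real is within 1 of its floor. *)
Lemma nonresonance_le1 (d : nat) (beta : 'cV[R]_d) (T phi : R) :
  (0 < d)%N -> 1 <= T ->
  (forall u : 'cV[int]_d, u != 0 -> `|intvec R u| <= T ->
     phi <= distZ (dotv (intvec R u) beta)) -> phi <= 1.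
Proof.
move=> d0 T1 nores; have u0 : const_mx 1 != 0 :> 'cV[int]_d.
  by apply/eqP => /matrixP/(_ (Ordinal d0) 0); rewrite !mxE.
apply: le_trans (nores _ u0 _) _.
  apply: intvec_norm_le => [|j]; first exact: le_trans T1.
  by rewrite mxE normr1.
set y := dotv _ _; apply: le_trans (distZ_le y (Num.floor y)) _.
have /andP[] := floor_itv y; rewrite intrD => y1 y2.
by rewrite ler_norml; lra.
Qed.

(* Replacing [beta] by [b / Q] with [Q] large, apply [discrete_kronecker] to
   the subgroup generated by [(1, b) / Q]: its first coordinate controls the
   size of the time [k]. *)
Lemma kronecker (d : nat) (beta : 'cV[R]_d) (T phi : R) (x : 'I_d -> R) :
  (0 < d)%N -> 1 <= T -> 0 < phi ->
  (forall u : 'cV[int]_d, u != 0 -> `|intvec R u| <= T ->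
     phi <= distZ (dotv (intvec R u) beta)) ->
  exists (k : int) (m : 'I_d -> int), `|k%:~R| <= 9 / phi :> R /\
    \sum_j `|x j + k%:~R * beta j 0 - (m j)%:~R| <= d%:R / T.
Proof.
move=> d0 T1 phi0 nores.
have phi1 := nonresonance_le1 d0 T1 nores.
have T0 : 0 < T by exact: lt_le_trans T1.
have d1 : 1 <= d%:R :> R by rewrite ler1n.
(* The term [2 * d%:R] leaves room for rounding [beta] in the resonance argument; 60 keeps the final
   rounding error below [1 / (6 * T)]. *)
have [Q Q0 QT] : exists2 Q : nat, (0 < Q)%N & (60 + 2 * d%:R) * T < phi * Q%:R.
  have [|q /andP[_ qQ]] := @exists_nat_itv ((60 + 2 * d%:R) * T / phi).
    by rewrite divr_ge0 ?mulr_ge0 ?ltW// addr_gt0 ?mulr_gt0 ?ltr0n.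
  by exists q.+1 => //; rewrite [phi * _]mulrC -ltr_pdivrMr.
have Qr0 : 0 < Q%:R :> R by rewrite ltr0n.
have [|L0 /andP[L0l]] := @exists_nat_itv (phi * Q%:R / 2).
  by rewrite divr_ge0 ?mulr_ge0 ?ltW.
rewrite -[L0.+1%:R]natr1 => L0r.
have [|K /andP[KT]] := @exists_nat_itv T; first exact: ltW.
rewrite -natr1 => TK; pose L := K.+1.
have LE : L%:R = K%:R + 1 :> R by rewrite -natr1.
have dT : 0 <= d%:R * T by rewrite mulr_ge0 ?ler0n ?ltW.
have Q60 : 60 < phi * Q%:R by lra.
have L0big : phi * Q%:R / 3 <= L0%:R by lra.
have L0Q : L0%:R <= Q%:R :> R by nra.
pose b j := Num.floor (Q%:R * beta j 0).
have b01 j : 0 <= Q%:R * beta j 0 - (b j)%:~R <= 1.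
  by have /andP[] := floor_itv (Q%:R * beta j 0); rewrite intrD -/(b j); lra.
(* This weight makes the time coordinate contribute exactly [d%:R / T ^+ 2] to the bound of
   [discrete_kronecker]. *)
pose lam0 : R := d%:R * (L0%:R ^+ 2 + 1) / (10 * T ^+ 2).
have lam0_ge0 : 0 <= lam0.
  by rewrite divr_ge0 ?(mulr_ge0 (ler0n _ _)) ?addr_ge0 ?sqr_ge0.
have nores' (c : 'I_d.+1 -> int) :
    (forall i, `|c i| < (consf L0 (fun=> L) i)%:Z) ->
    (Q%:Z %| \sum_i c i * consf 1 b i)%Z -> forall i, c i = 0.
  move=> cL /dvdzP[q]; rewrite big_ord_recl consf0 mulr1.
  under eq_bigr do rewrite consfS.
  have c0L : `|(c ord0)%:~R| < L0%:R :> R.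
    by have := cL ord0; rewrite consf0 -intr_norm pmulrn ltr_int.
  have cjL j : `|(c (lift ord0 j))%:~R| <= T :> R.
    apply: le_trans KT; have := cL (lift ord0 j); rewrite consfS /L.
    by rewrite -intr_norm pmulrn ler_int -[K.+1]addn1 PoszD ltzD1.
  pose u : 'cV[int]_d := \col_j c (lift ord0 j).
  (* If [u] is nonzero, a resonance of [(1, b) / Q] puts [Q * dotv u beta] within less than
     [d * T + L0], hence less than [phi * Q], of a multiple of [Q], against [nores]. If [u] is zero,
     [Q] divides [c ord0], which is smaller than [L0 <= Q]. *)
  have [u0|u0] := eqVneq u 0 => Eq; last first.
    have uT : `|intvec R u| <= T.
      by apply: intvec_norm_le => [|j]; [exact: ltW|rewrite mxE].
    have := le_trans (nores _ u0 uT) (distZ_le _ q).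
    rewrite -(ler_pM2r Qr0) -[X in _ <= _ * X](gtr0_norm Qr0) -normrM.
    have EqR : (c ord0)%:~R + \sum_j (c (lift ord0 j))%:~R * (b j)%:~R
        = q%:~R * Q%:R :> R.
      move/(congr1 (fun z : int => z%:~R : R)): Eq; rewrite intrD intrM => <-.
      by rewrite rmorph_sum/=; congr (_ + _); apply: eq_bigr => j _; rewrite intrM.
    have -> : (dotv (intvec R u) beta - q%:~R) * Q%:R =
        \sum_j (c (lift ord0 j))%:~R * (Q%:R * beta j 0 - (b j)%:~R)
        - (c ord0)%:~R.
      rewrite mulrBl -EqR opprD addrA addrAC mulr_suml -sumrB.
      by congr (_ - _); apply: eq_bigr => j _; rewrite !mxE; ring.
    move=> phiQ; suff : phi * Q%:R < phi * Q%:R by rewrite ltxx.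
    apply: le_lt_trans phiQ (le_lt_trans (ler_normB _ _) _).
    apply: (@lt_le_trans _ _ (d%:R * T + L0%:R)); last by lra.
    apply: ler_ltD => //; apply: le_trans (ler_norm_sum _ _ _) _.
    rewrite mulrC mulr_natr -[in leRHS](card_ord d) -sumr_const ler_sum// => j _.
    rewrite normrM -[leRHS]mulr1 ler_pM//.
    by have := b01 j; case/andP => ? ?; rewrite ger0_norm.
  have cj0 j : c (lift ord0 j) = 0.
    by move/matrixP/(_ j 0): u0; rewrite !mxE.
  move: Eq; rewrite big1 ?addr0 => [Eq i|j _]; last by rewrite cj0 mul0r.
  case: (unliftP ord0 i) => [j ->//|->].
  move: c0L; rewrite Eq intrM normrM [`|Q%:~R|]gtr0_norm//.
  have [-> _|q0] := eqVneq q 0; first by rewrite mul0r.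
  have : 1 <= `|q%:~R| :> R by rewrite -intr_norm ler1z -gtz0_ge1 normr_gt0.
  by rewrite -pmulrn => q1 qL; exfalso; nra.
have [i|k] := @discrete_kronecker R _ _ _ (consf 0 x) (consf lam0 (fun=> 1)) Q
   Q0 _ nores'.
  rewrite /consf; case: unliftP => [j|] _.
    by rewrite -(ltr_nat R); lra.
  by rewrite -(ltr_nat R); lra.
rewrite !big_ord_recl !consf0 add0r.
under eq_bigr do rewrite !consfS mul1r.
under [in X in _ <= X -> _]eq_bigr do rewrite !consfS mul1r.
rewrite sumr_const card_ord => kle.
have [r rE] := exists_int_chord (k%:R * (1%:~R / Q%:R) : R).
have /choice[m mE] := fun j => exists_int_chord (x j + k%:R * ((b j)%:~R / Q%:R)).
pose e j := x j + k%:R * ((b j)%:~R / Q%:R) - (m j)%:~R.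
(* The time is defined only modulo [Q]: take the representative near 0. Each [k * b j / Q] then
   shifts by the integer [r * b j]. *)
pose k' : int := k%:Z - r * Q%:Z.
have {kle} kle : lam0 * (16 * (k'%:~R / Q%:R) ^+ 2) + \sum_j 16 * e j ^+ 2
    <= 11 * d%:R / T ^+ 2.
  apply: (@le_trans _ _ _ _ _ (le_trans _ kle)).
    apply: lerD; last by apply: ler_sum => j _; exact: mE.
    apply: ler_wpM2l => //.
    apply: le_trans rE; rewrite le_eqVlt; apply/orP; left; apply/eqP.
    by rewrite /k' intrB intrM -!pmulrn; field; rewrite gt_eqF.
  have -> : lam0 * (10 / (L0%:R ^+ 2 + 1)) = d%:R / T ^+ 2.
    have L0n : L0%:R ^+ 2 + 1 != 0 :> R by rewrite gt_eqF// ltr_wpDl// sqr_ge0.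
    by rewrite /lam0; field; rewrite (gt_eqF T0) L0n.
  have : 10 / (L%:R ^+ 2 + 1) *+ d <= 10 * d%:R / T ^+ 2.
    rewrite -mulr_natr mulrAC ler_pM2l ?mulr_gt0 ?ltr0n//.
    rewrite lef_pV2 ?posrE ?exprn_gt0 ?ltr_wpDl ?sqr_ge0// LE.
    by nra.
  have -> : 11 * d%:R / T ^+ 2 = d%:R / T ^+ 2 + 10 * d%:R / T ^+ 2 by ring.
  by rewrite lerD2l.
have k'le : `|k'%:~R| <= 9 / phi :> R.
  have : lam0 * (16 * (k'%:~R / Q%:R) ^+ 2) <= 11 * d%:R / T ^+ 2.
    apply: le_trans kle; rewrite lerDl sumr_ge0// => j _.
    by rewrite mulr_ge0 ?sqr_ge0.
  have -> : lam0 * (16 * (k'%:~R / Q%:R) ^+ 2) =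
     d%:R / T ^+ 2 * (16 / 10 * (L0%:R ^+ 2 + 1) * (k'%:~R / Q%:R) ^+ 2).
    by rewrite /lam0; field; rewrite !gt_eqF.
  rewrite [leRHS](_ : _ = d%:R / T ^+ 2 * 11); last by ring.
  rewrite ler_pM2l ?divr_gt0 ?exprn_gt0 ?ltr0n//.
  (* The square is at most 110/16, below 9; with [L0 >= phi * Q / 3] this yields the bound
     [9 / phi]. *)
  move=> kL; have {kL} : (L0%:R * (`|k'%:~R| / Q%:R)) ^+ 2 <= 3 ^+ 2 :> R.
    have -> : (L0%:R * (`|k'%:~R| / Q%:R)) ^+ 2 =
        L0%:R ^+ 2 * (k'%:~R / Q%:R) ^+ 2 :> R.
      by rewrite !exprMn real_normK// num_real.
    have := sqr_ge0 (k'%:~R / Q%:R : R); lra.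
  have kL0 : 0 <= L0%:R * (`|k'%:~R| / Q%:R) :> R by rewrite mulr_ge0// divr_ge0.
  rewrite ler_sqr ?nnegrE// => kL.
  rewrite ler_pdivlMr//; have : phi / 3 * `|k'%:~R| <= 3; last by lra.
  apply: le_trans kL; rewrite mulrA [leRHS]mulrAC ler_wpM2r//.
  by rewrite ler_pdivlMr// mulrAC.
exists k', (fun j => m j - r * b j); split=> //.
have ele : \sum_j 16 * e j ^+ 2 <= 11 * d%:R / T ^+ 2.
  by apply: le_trans kle; rewrite lerDr mulr_ge0// mulr_ge0// sqr_ge0.
have xle j : `|x j + k'%:~R * beta j 0 - (m j - r * b j)%:~R| <=
    3 * T / 5 * e j ^+ 2 + 7 / (12 * T).
  have -> : x j + k'%:~R * beta j 0 - (m j - r * b j)%:~R =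
      e j + k'%:~R * ((Q%:R * beta j 0 - (b j)%:~R) / Q%:R).
    by rewrite /e /k' !intrB !intrM -!pmulrn; field; rewrite gt_eqF.
  (* The tangent parabola at [5 / (6 * T)] converts the bound on squares into one on absolute
     values. *)
  have ej : `|e j| <= 3 * T / 5 * e j ^+ 2 + 5 / (12 * T).
    rewrite -(real_normK (num_real (e j))) -subr_ge0.
    have -> : 3 * T / 5 * `|e j| ^+ 2 + 5 / (12 * T) - `|e j| =
        3 * T / 5 * (`|e j| - 5 / (6 * T)) ^+ 2 by field; rewrite gt_eqF.
    by rewrite mulr_ge0 ?sqr_ge0 ?divr_ge0 ?mulr_ge0 ?ltW.
  have kj : `|k'%:~R * ((Q%:R * beta j 0 - (b j)%:~R) / Q%:R)| <= 1 / (6 * T).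
    have /andP[bj0 bj1] := b01 j.
    have bQ : 0 <= (Q%:R * beta j 0 - (b j)%:~R) / Q%:R by rewrite divr_ge0.
    rewrite normrM (ger0_norm bQ).
    apply: (@le_trans _ _ (9 / phi * (1 / Q%:R))).
      by rewrite ler_pM// ler_pM2r ?invr_gt0.
    rewrite ler_pdivlMr ?mulr_gt0//.
    have -> : 9 / phi * (1 / Q%:R) * (6 * T) = 54 * T / (phi * Q%:R).
      by field; rewrite !gt_eqF.
    by rewrite ler_pdivrMr ?mulr_gt0//; lra.
  have -> : 7 / (12 * T) = 5 / (12 * T) + 1 / (6 * T) by field; rewrite gt_eqF.
  by rewrite addrA (le_trans (ler_normD _ _))// lerD.
apply: (@le_trans _ _ (\sum_j (3 * T / 5 * e j ^+ 2 + 7 / (12 * T)))).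
  by apply: ler_sum => j _; exact: xle.
rewrite big_split/= sumr_const card_ord -[_ *+ d]mulr_natr.
have -> : \sum_j 3 * T / 5 * e j ^+ 2 = 3 * T / 80 * \sum_j 16 * e j ^+ 2.
  by rewrite mulr_sumr; apply: eq_bigr => j _; field.
apply: (@le_trans _ _ (3 * T / 80 * (11 * d%:R / T ^+ 2) + 7 / (12 * T) * d%:R)).
  by rewrite lerD2r ler_wpM2l// divr_ge0 ?mulr_ge0 ?ltW.
(* The constants add up to 33/80 + 7/12 = 239/240. *)
rewrite -subr_ge0.
have -> : d%:R / T - (3 * T / 80 * (11 * d%:R / T ^+ 2) + 7 / (12 * T) * d%:R) =
    d%:R / T / 240 by field; rewrite gt_eqF.
by rewrite !divr_ge0// ltW.
Qed.

End Kronecker.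

(** * Dirichlet's theorem as an upper bound on nonresonance *)

Section Dirichlet.
Variable R : realType.

(** Pigeonhole: the [n.+2] integer vectors with entries in [[0, K]], where [K] is the floor of [T],
    send their fractional parts [fr] into [n.+1] boxes. Two vectors sharing a box differ by some [u]
    whose product with [beta] is within [1 / n.+1], hence [2 / n.+2], of an integer. *)
Lemma nonresonance_dirichlet (d : nat) (beta : 'cV[R]_d) (T phi : R) :
  (0 < d)%N -> 1 <= T ->
  (forall u : 'cV[int]_d, u != 0 -> `|intvec R u| <= T ->
     phi <= distZ (dotv (intvec R u) beta)) -> phi <= 2 / T ^+ d.
Proof.
move=> d0 T1 nores; have T0 : 0 < T by exact: lt_le_trans T1.
have [|K /andP[KT TK]] := @exists_nat_itv R T; first exact: ltW.
have K0 : (0 < K)%N by rewrite -(ltr_nat R) -(ltrD2r 1) natr1; lra.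
have K2 : (2 <= K.+1 ^ d)%N by rewrite (leq_trans _ (ltn_expl d _)).
have [n nE] : exists n, (K.+1 ^ d = n.+2)%N.
  by case: (K.+1 ^ d)%N K2 => [|[|n]]// _; exists n.
pose y (f : {ffun 'I_d -> 'I_K.+1}) : R := \sum_j (f j)%:R * beta j 0.
pose fr f := y f - (Num.floor (y f))%:~R.
have fr01 f : 0 <= fr f < 1.
  by have /andP[] := floor_itv (y f); rewrite intrD /fr; lra.
have box_lt f : (Num.truncn (n.+1%:R * fr f) < n.+1)%N.
  have /andP[f0 f1] := fr01 f.
  rewrite -(ltr_nat R); apply: (@le_lt_trans _ _ (n.+1%:R * fr f)).
    by rewrite truncn_le mulr_ge0.
  by rewrite -[ltRHS]mulr1 ltr_pM2l.
pose box f : 'I_n.+1 := Ordinal (box_lt f).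
have /injectivePn[f [g fg boxE]] : ~~ injectiveb box.
  apply/negP => /injectiveP/leq_card; rewrite card_ffun !card_ord nE.
  by rewrite ltnn.
pose u : 'cV[int]_d := \col_j ((f j)%:Z - (g j)%:Z).
have u0 : u != 0.
  apply: contra_neq fg => /matrixP u0; apply/ffunP => j; apply/val_inj.
  by move: (u0 j 0); rewrite !mxE => /eqP; rewrite subr_eq0 => /eqP[].
have uT : `|intvec R u| <= T.
  apply: intvec_norm_le => [|j]; first exact: ltW.
  apply: le_trans KT; rewrite mxE -intr_norm pmulrn ler_int.
  by have := ltn_ord (f j); have := ltn_ord (g j); clear; lia.
apply: le_trans (nores _ u0 uT) _.
apply: le_trans (distZ_le _ (Num.floor (y f) - Num.floor (y g))) _.
have -> : dotv (intvec R u) beta - (Num.floor (y f) - Num.floor (y g))%:~R =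
    fr f - fr g.
  have -> : dotv (intvec R u) beta = y f - y g.
    rewrite -sumrB; apply: eq_bigr => j _; rewrite !mxE intrB -!pmulrn; ring.
  by rewrite intrB /fr; ring.
apply: (@le_trans _ _ (n.+1%:R^-1)).
  have itv h : (box h)%:R <= n.+1%:R * fr h < (box h)%:R + 1.
    by rewrite natr1; apply: truncn_itv; rewrite mulr_ge0//; have /andP[] := fr01 h.
  have := itv f; have := itv g; rewrite boxE => /andP[g1 g2] /andP[f1 f2].
  rewrite -[leRHS]mulr1 -ler_pdivrMl ?invr_gt0// invrK.
  by rewrite -[X in X * _](@gtr0_norm R n.+1%:R)// -normrM mulrBr ler_norml; lra.
have Tn : T ^+ d <= n.+2%:R.
  by rewrite -nE natrX lerXn2r ?nnegrE// ltW.
rewrite -[leLHS]mul1r ler_pdivrMr// mulrAC ler_pdivlMr ?exprn_gt0// mul1r.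
apply: le_trans Tn _; rewrite -natrM ler_nat; lia.
Qed.

End Dirichlet.

(** * Segments near the forest *)

Section Forest.
Variable R : realType.

Lemma forest1_col (d s : nat) (Theta : 'I_s -> 'cV[R]_d) (i : 'I_s) (k : int)
    (m : 'I_d -> int) :
  forest1 Theta (col_mx (const_mx k%:~R)
                        (\col_j (Theta i j 0 * k%:~R + (m j)%:~R))).
Proof.
exists i => //; exists (col_mx (const_mx k) (\col_j m j)) => //.
rewrite /shear /intvec map_col_mx mul_block_col !mul1mx mul0mx addr0.
by congr col_mx; apply/matrixP => a b; rewrite !mxE// big_ord1 !mxE.
Qed.

(* At the integer times [k] the line through [x] in direction [delta] moves by
   multiples of the slope vector of [delta], so relative to the points
   [(k, k Theta_i + m)] it performs a translation orbit on the torus. *)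
Lemma near_forest1 (d s : nat) (Phi : R -> R) (Theta : 'I_s -> 'cV[R]_d)
    (T : R) (x delta : 'cV[R]_(1 + d)) :
  (0 < d)%N -> 1 <= T -> 0 < Phi T -> UDT Phi Theta ->
  22 / Phi T <= `|delta 0 0| ->
  exists t z, [/\ 0 <= t <= 1, forest1 Theta z &
    \sum_j `|(x + t *: delta) j 0 - z j 0| <= d%:R / T].
Proof.
move=> d0 T1 phi0 udt dlarge.
have D0 : 0 < `|delta 0 0| by apply: lt_le_trans dlarge; rewrite divr_gt0.
have Dn0 : delta 0 0 != 0 by rewrite -normr_gt0.
pose alpha : 'cV[R]_d := \col_j (delta (rshift 1 j) 0 / delta 0 0).
have [i nores] := udt T T1 alpha.
have phi1 := nonresonance_le1 d0 T1 nores.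
(* Times are counted from the middle of the segment, so that small [k] of either sign stay inside:
   [9 / Phi T] plus 1 for the floor is at most [11 / Phi T], half of the required extent. *)
pose mid := x 0 0 + delta 0 0 / 2; pose k0 := Num.floor mid.
have [k [m [kle mle]]] := kronecker (fun j => x (rshift 1 j) 0 +
  (k0%:~R - x 0 0) * alpha j 0 - k0%:~R * Theta i j 0) d0 T1 phi0 nores.
pose k1 : R := (k0 + k)%:~R.
have k1mid : `|k1 - mid| <= `|delta 0 0| / 2.
  have -> : k1 - mid = k%:~R - (mid - k0%:~R) by rewrite /k1 intrD; ring.
  apply: le_trans (ler_normB _ _) _.
  have m1 : `|mid - k0%:~R| <= 1.
    by have /andP[] := floor_itv mid; rewrite intrD -/k0 ler_norml; lra.
  have : 1 <= 1 / Phi T by rewrite ler_pdivlMr// mul1r.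
  lra.
pose t := (k1 - x 0 0) / delta 0 0.
have tE : t * delta 0 0 = k1 - x 0 0 by rewrite divfK.
exists t, (col_mx (const_mx (k0 + k)%:~R)
  (\col_j (Theta i j 0 * (k0 + k)%:~R + (m j)%:~R))); split.
- have /andP[] : - (1 / 2) <= t - 1 / 2 <= 1 / 2.
    rewrite -ler_norml -(ler_pM2r D0) -normrM.
    have -> : (t - 1 / 2) * delta 0 0 = k1 - mid by rewrite mulrBl tE /mid; ring.
    lra.
  by lra.
- exact: forest1_col.
rewrite big_split_ord/= big_ord1.
rewrite col_mxEu !mxE (_ : lshift d ord0 = 0); last exact/val_inj.
rewrite tE -/k1 addrCA subrr addr0 subrr normr0 add0r.
apply: le_trans mle; rewrite le_eqVlt; apply/orP; left; apply/eqP.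
apply: eq_bigr => j _; rewrite col_mxEd !mxE -/k1; congr `|_|.
have -> : t * delta (rshift 1 j) 0 =
    (k1 - x 0 0) * (delta (rshift 1 j) 0 / delta 0 0).
  by rewrite mulrAC mulrA.
by rewrite /k1 intrD; ring.
Qed.

Lemma iter_ordS (n : nat) (l : nat) (j : 'I_n) :
  iter l (@ordS n) j = ((j + l) %% n)%N :> nat.
Proof.
elim: l => [|l IHl]; first by rewrite addn0 modn_small.
by rewrite iterS/= IHl -addn1 modnDml -addnA addn1.
Qed.

Lemma iter_rotvE (n : nat) (l : nat) (z : 'cV[R]_n) (j : 'I_n) :
  iter l (@rotv R n) z j 0 = z (iter l (@ordS n) j) 0.
Proof. by elim: l j => //= l IHl j; rewrite mxE IHl -iterSr. Qed.

(** Some rotation brings any chosen coordinate to the front. *)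
Lemma exists_iter_ordS (n : nat) (j : 'I_n.+1) :
  exists l : 'I_n.+1, iter l (@ordS n.+1) j = 0.
Proof.
exists (Ordinal (ltn_pmod (n.+1 - j) (ltn0Sn n))); apply/val_inj => /=.
by rewrite iter_ordS modnDmr subnKC ?modnn// ltnW.
Qed.

Lemma norm_le_sum (n : nat) (N : 'cV[R]_n -> R) : is_norm N ->
  (forall j, N (delta_mx j 0) <= 1) ->
  forall w, N w <= \sum_j `|w j 0|.
Proof.
move=> [_ NZ ND] N1 w.
have -> : w = \sum_j w j 0 *: delta_mx j 0.
  by rewrite {1}[w]matrix_sum_delta; apply: eq_bigr => j _; rewrite big_ord1.
rewrite [leRHS](eq_bigr (fun j => `|w j 0|)).
  elim/big_rec2: _ => [|j a b _ ab].
    by rewrite -[0](scale0r 0) NZ normr0 mul0r.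
  by apply: le_trans (ND _ _) _; rewrite lerD// NZ ler_piMr.
move=> j _; congr `|_|; rewrite summxE (bigD1 j)//= !mxE !eqxx mulr1 big1 ?addr0//.
by move=> i /negPf ij; rewrite !mxE eq_sym ij mulr0.
Qed.

(** Some entry is at least the average, by the mean lemma applied to the negated absolute values. *)
Lemma exists_large_coord (n : nat) (w : 'cV[R]_n.+1) :
  exists j, \sum_i `|w i 0| <= n.+1%:R * `|w j 0|.
Proof.
have [|||j] := @exists_le_weighted_mean R n.+1 (fun=> 1)
  (fun j => - `|w j 0|) (- (\sum_i `|w i 0|) / n.+1%:R).
- by [].
- by rewrite sumr_const card_ord ltr0n.
- rewrite sumr_const card_ord divfK ?pnatr_eq0//.
  by under eq_bigr do rewrite mul1r; rewrite sumrN.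
by move=> wj; exists j; move: wj; rewrite mulNr lerN2 ler_pdivrMr// mulrC.
Qed.

(** Rotate the coordinates so that a dominant one of [y - x] comes first; comparing it with the
    whole sum costs the factor [1 + d]. The inverse permutation [tau] carries the segment over, and
    the rotated copies of [forest1] in the forest bring the point found back. *)
Lemma near_forest (d s : nat) (Phi : R -> R) (Theta : 'I_s -> 'cV[R]_d)
    (N : 'cV[R]_(1 + d) -> R) (T : R) (x y : 'cV[R]_(1 + d)) :
  is_norm N -> (forall j, N (delta_mx j 0) <= 1) ->
  (0 < d)%N -> 1 <= T -> 0 < Phi T -> UDT Phi Theta ->
  22 * (1 + d)%:R / Phi T <= N (y - x) ->
  exists p q, [/\ segment x y p, forest Theta q & N (p - q) <= d%:R / T].
Proof.
move=> Nn N1 d0 T1 phi0 udt Nle.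
have [j jle] := exists_large_coord (y - x).
have [l lj] := exists_iter_ordS j.
have inj : injective (iter l (@ordS (1 + d))).
  by elim: (nat_of_ord l) => //= n IHn a b /ordS_inj/IHn.
have [tau sK tK] := injF_bij inj.
have tau0 : tau 0 = j by rewrite -lj sK.
have [|t [z [t01 zF zle]]] := @near_forest1 d s Phi Theta T
  (\col_i x (tau i) 0) (\col_i (y - x) (tau i) 0) d0 T1 phi0 udt.
  rewrite mxE tau0 -(ler_pM2l (_ : 0 < (1 + d)%:R)) ?ltr0n//.
  rewrite mulrCA mulrA; apply: le_trans Nle (le_trans (norm_le_sum Nn N1 _) jle).
exists (x + t *: (y - x)), (iter l (@rotv R (1 + d)) z); split.
- by exists t => //; rewrite /= in_itv.
- by exists l => //; exists z.
apply: le_trans (norm_le_sum Nn N1 _) (le_trans _ zle).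
rewrite [leRHS](reindex_inj inj)/= le_eqVlt; apply/orP; left; apply/eqP.
by apply: eq_bigr => a _; rewrite !mxE iter_rotvE sK.
Qed.

End Forest.

Theorem theorem5p2 (R : realType) (d s : nat) (d_ge1 : (1 <= d)%N)
    (s_ge2 : (2 <= s)%N) (Phi : R -> R)
    (Phi_gt0 : forall T : R, 1 <= T -> 0 < Phi T)
    (Phi_noninc : forall T T' : R, 1 <= T -> T <= T' -> Phi T' <= Phi T)
    (Phi_cvg0 : Phi T @[T --> +oo] --> (0 : R))
    (N : 'cV[R]_(1 + d) -> R) (N_norm : is_norm N)
    (N_unit : forall j : 'I_(1 + d), N (delta_mx j 0) <= 1) :
  exists C eps0 : R, [/\ 0 < C, 0 < eps0 &
    forall Theta : 'I_s -> 'cV[R]_d, UDT Phi Theta ->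
    exists v : R -> R,
      dense_forest N (forest Theta) v /\
      forall eps : R, 0 < eps < eps0 ->
        v eps <= C * (eps ^+ (d - 1) * (Phi (d%:R / eps))^-1) ^+ d].
Proof.
(* A dense forest concerns every positive [eps]; capping at 1 keeps [T eps >= 1] when [eps] is
   large. *)
pose T (eps : R) : R := d%:R / Num.min eps 1.
have d1 : 1 <= d%:R :> R by rewrite ler1n.
have T_ge1 eps : 0 < eps -> 1 <= T eps.
  move=> eps0; have m0 : 0 < Num.min eps 1 by rewrite lt_min eps0 ltr01.
  by rewrite ler_pdivlMr// mul1r (le_trans _ d1)// ge_min lexx orbT.
exists (22 * (1 + d)%:R * 2 ^+ (d - 1)), 1; split => //.
move=> Theta udt; exists (fun eps => 22 * (1 + d)%:R / Phi (T eps)); split.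
  move=> eps eps0; have phi0 := Phi_gt0 _ (T_ge1 _ eps0).
  split=> [|x y Nxy]; first by rewrite divr_gt0// mulr_gt0// ltr0n.
  have [|p [q [px Yq pq]]] :=
    near_forest N_norm N_unit d_ge1 (T_ge1 _ eps0) phi0 udt (x := x) (y := y).
    by rewrite Nxy.
  exists p, q; split=> //; apply: le_trans pq _.
  rewrite /T invf_div mulrCA divff ?mulr1 ?pnatr_eq0 -?lt0n//.
  by rewrite ge_min lexx.
move=> eps /andP[eps0 eps1]; have := T_ge1 _ eps0.
have -> : T eps = d%:R / eps by rewrite /T min_l// ltW.
set t := d%:R / eps => t1; have phi0 := Phi_gt0 _ t1.
have [i nores] := udt t t1 0.
have phi_le : Phi t <= 2 * eps ^+ d.
  apply: le_trans (nonresonance_dirichlet d_ge1 t1 nores) _.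
  have tV : t^-1 <= eps.
    by rewrite invf_div ler_pdivrMr ?(lt_le_trans _ d1)// ler_peMr// ltW.
  rewrite ler_pM2l// -exprVn lerXn2r// nnegrE ?invr_ge0 ltW//.
  exact: lt_le_trans t1.
rewrite -[leRHS]mulrA ler_pM2l ?mulr_gt0 ?ltr0n//.
move: (Phi t) phi0 phi_le => phi phi0 phi_le.
(* After clearing denominators, the claim is the [(d - 1)]-th power of [phi <= 2 * eps ^+ d], whence
   the constant [2 ^+ (d - 1)]. *)
have dE : d = (d - 1).+1 by rewrite subn1 prednK.
rewrite exprMn exprVn -exprM mulnC exprM mulrA -exprMn ler_pdivlMr ?exprn_gt0//.
rewrite [X in phi ^+ X]dE exprS mulKf ?gt_eqF// lerXn2r// nnegrE ltW//.
by rewrite mulr_gt0 ?exprn_gt0.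
Qed.
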